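(* Every full-dimensional maximal $Q_g$-free set $K \subseteq H$ is of the form $K = C^G_\Gamma \cap H$ for some function $\Gamma : D^m \to D^n$ such that $C_\Gamma$ is a full-dimensional maximal $Q_h$-free set, where $G = G(\Gamma,\mathbf a,\mathbf d)$.
   Context: Fix integers $n,m\ge 1$ and $(\mathbf a,\mathbf d)\in\mathbb R^n\times\mathbb R^m$ with $\max\{\|\mathbf a\|,\|\mathbf d\|\}=1$, where $\|\cdot\|$ is the Euclidean norm. Define $Q_h=\{(\mathbf x,\mathbf y)\in\mathbb R^n\times\mathbb R^m:\|\mathbf x\|\le\|\mathbf y\|\}$, $H=\{(\mathbf x,\mathbf y)\in\mathbb R^n\times\mathbb R^m:\mathbf a^\top\mathbf x+\mathbf d^\top\mathbf y=-1\}$, and $Q_g=Q_h\cap H$. A closed convex set $C\subseteq\mathbb R^n\times\mathbb R^m$ is $Q_h$-free if its interior is disjoint from $Q_h$; it is maximal $Q_h$-free if it is $Q_h$-free and not a strict subset of another $Q_h$-free set; it is full-dimensional if it has dimension $n+m$. A set $K\subseteq H$ is full-dimensional if it has dimension $n+m-1$. A full-dimensional closed convex set $K\subseteq H$ is $Q_g$-free if its relative interior is disjoint from $Q_g$; it is maximal $Q_g$-free if it is $Q_g$-free and not a strict subset of another $Q_g$-free set contained in $H$. Let $D^k=\{\mathbf x\in\mathbb R^k:\|\mathbf x\|=1\}$. For $\Gamma:D^m\to D^n$ and $I\subseteq D^m$, let $C^I_\Gamma=\{(\mathbf x,\mathbf y)\in\mathbb R^n\times\mathbb R^m: -\Gamma(\boldsymbol\beta)^\top\mathbf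 x+\boldsymbol\beta^\top\mathbf y\le 0\ \ \forall\,\boldsymbol\beta\in I\}$, $C_\Gamma=C^{D^m}_\Gamma$, and $G=G(\Gamma,\mathbf a,\mathbf d)=\{\boldsymbol\beta\in D^m:\mathbf a^\top\Gamma(\boldsymbol\beta)+\mathbf d^\top\boldsymbol\beta\le 0\}$. *)

(* Defs.v *)
From mathcomp Require Import all_boot all_order all_algebra.
From mathcomp Require Import all_classical all_reals all_analysis.

Set Implicit Arguments.
Unset Strict Implicit.
Unset Printing Implicit Defensive.

Import Order.TTheory GRing.Theory Num.Theory.
Import numFieldNormedType.Exports.

Local Open Scope classical_set_scope.
Local Open Scope ring_scope.

Definition dot (R : realType) (k : nat) (u v : 'cV[R]_k) : R :=
  (u^T *m v) 0 0.

(* The library norm on matrices is the sup norm; it induces the same topology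
   as the Euclidean norm, but the quadratic sets below need the latter. *)
Definition enorm (R : realType) (k : nat) (u : 'cV[R]_k) : R :=
  Num.sqrt (dot u u).

Definition affine_hull (R : realType) (V : vectType R) (A : set V) : set V :=
  [set v | exists (k : nat) (p : 'I_k -> V) (c : 'I_k -> R),
     [/\ forall i, A (p i), \sum_(i < k) c i = 1
       & v = \sum_(i < k) c i *: p i]].

(* The affine hull of [A] is a translate of a [k]-dimensional linear subspace;
   in particular [A] is nonempty, so the empty set has no dimension. *)
Definition has_dim (R : realType) (V : vectType R) (A : set V) (k : nat) :
    Prop :=
  exists (x : V) (U : {vspace V}),
    affine_hull A = [set v | v - x \in U] /\ \dim U = k.

Section QuadraticFree.
Variables (R : realType) (n m : nat).
Implicit Types (a : 'cV[R]_n) (d : 'cV[R]_m).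
Implicit Types (C K : set ('cV[R]_n * 'cV[R]_m)).

Definition relint K : set ('cV[R]_n * 'cV[R]_m) :=
  [set p | K p /\ \forall q \near p, affine_hull K q -> K q].

Definition Qh : set ('cV[R]_n * 'cV[R]_m) :=
  [set p | enorm p.1 <= enorm p.2].

Definition hyperplane a d : set ('cV[R]_n * 'cV[R]_m) :=
  [set p | dot a p.1 + dot d p.2 = -1].

Definition Qg a d : set ('cV[R]_n * 'cV[R]_m) := Qh `&` hyperplane a d.

Definition Qh_free C : Prop :=
  [/\ closed C, convex_set C & C° `&` Qh = set0].

Definition maximal_Qh_free C : Prop :=
  Qh_free C /\ ~ (exists C', Qh_free C' /\ C `<` C').

Definition full_dimensional C : Prop := has_dim C (n + m).

Definition full_dimensional_in_hyperplane K : Prop := has_dim K (n + m - 1).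

Definition Qg_free a d K : Prop :=
  [/\ K `<=` hyperplane a d, full_dimensional_in_hyperplane K,
      closed K, convex_set K & relint K `&` Qg a d = set0].

Definition maximal_Qg_free a d K : Prop :=
  Qg_free a d K /\ ~ (exists K', Qg_free a d K' /\ K `<` K').

End QuadraticFree.

Definition usphere (R : realType) (k : nat) : set 'cV[R]_k :=
  [set u | enorm u = 1].

(* [Gamma] is total on column vectors, but only its values on the unit sphere
   matter: [I] is always a subset of the sphere, which [Gamma] maps into the
   sphere. *)
Definition Cset (R : realType) (n m : nat) (Gamma : 'cV[R]_m -> 'cV[R]_n)
    (I : set 'cV[R]_m) : set ('cV[R]_n * 'cV[R]_m) :=
  [set p | forall b, I b -> - dot (Gamma b) p.1 + dot b p.2 <= 0].

Definition Gset (R : realType) (n m : nat) (Gamma : 'cV[R]_m -> 'cV[R]_n)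
    (a : 'cV[R]_n) (d : 'cV[R]_m) : set 'cV[R]_m :=
  [set b | usphere b /\ dot a (Gamma b) + dot d b <= 0].

(* Main.v *)
(** The form [lform p q = p.2 . q.2 - p.1 . q.1] is nonnegative on the diagonal
    exactly on [Qh]. Since relint K avoids [Qh], the cone over K is a convex cone
    on which [lform p p <= 0]; take C maximal among such cones. For every unit b,
    a separation argument gives a unit vector [Gamma b] such that the null vector
    [(Gamma b, b)] satisfies [lform (Gamma b, b) p <= 0] on C; adding it to C keeps
    the diagonal nonpositive, so by maximality it lies in C. Hence K is contained
    in C, which is contained in [C_Gamma], and the contact points [(Gamma b, b)]
    all lie in [C_Gamma], which makes [C_Gamma] maximal [Qh]-free.

    On the hyperplane the constraint of index b can be relaxed to
    [lform (Gamma b, b) p <= 2 max (0, a . Gamma b + d . b)] without losing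
    [Qg]-freeness, so by maximality K already contains this relaxed set. The
    constraints with b outside G are therefore slack on K, and a compactness
    argument shows that they are redundant. *)

Require Import Defs.
From mathcomp Require Import all_boot all_order all_algebra.
From mathcomp Require Import all_classical all_reals all_analysis.
From mathcomp Require Import ring lra.
Set Implicit Arguments.
Unset Strict Implicit.
Unset Printing Implicit Defensive.
Import Order.TTheory GRing.Theory Num.Theory.
Import numFieldNormedType.Exports.
Local Open Scope classical_set_scope.
Local Open Scope ring_scope.

(** * Euclidean geometry of column vectors *)

Section Euclidean.
Variables (R : realType) (k : nat).
Implicit Types u v w : 'cV[R]_k.

Lemma dotE u v : dot u v = \sum_i u i 0 * v i 0.
Proof. by rewrite /dot mxE; apply: eq_bigr => i _; rewrite mxE. Qed.

Lemma dotC u v : dot u v = dot v u.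
Proof. by rewrite !dotE; apply: eq_bigr => i _; rewrite mulrC. Qed.

Lemma dotDl u v w : dot (u + v) w = dot u w + dot v w.
Proof. by rewrite /dot linearD mulmxDl mxE. Qed.

Lemma dotZl c u v : dot (c *: u) v = c * dot u v.
Proof. by rewrite /dot linearZ -scalemxAl mxE. Qed.

Lemma dotDr u v w : dot w (u + v) = dot w u + dot w v.
Proof. by rewrite dotC dotDl !(dotC w). Qed.

Lemma dotZr c u v : dot u (c *: v) = c * dot u v.
Proof. by rewrite dotC dotZl dotC. Qed.

Lemma dotNl u v : dot (- u) v = - dot u v.
Proof. by rewrite -scaleN1r dotZl mulN1r. Qed.

Lemma dotNr u v : dot u (- v) = - dot u v.
Proof. by rewrite dotC dotNl dotC. Qed.

Lemma dot0l v : dot 0 v = 0.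
Proof. by rewrite -(scale0r v) dotZl mul0r. Qed.

Lemma dot0r v : dot v 0 = 0.
Proof. by rewrite dotC dot0l. Qed.

Definition dot_lin := (dotDl, dotDr, dotNl, dotNr, dotZl, dotZr).

Lemma dot_ge0 u : 0 <= dot u u.
Proof. by rewrite dotE; apply: sumr_ge0 => i _; rewrite -expr2 sqr_ge0. Qed.

Lemma dot_eq0 u : dot u u = 0 -> u = 0.
Proof.
rewrite dotE => /eqP; rewrite psumr_eq0 => [/allP h|i _]; last first.
  by rewrite -expr2 sqr_ge0.
apply/colP => i; rewrite mxE; have := h i; rewrite mem_index_enum => /(_ isT).
by rewrite /= mulf_eq0 orbb => /eqP.
Qed.

(** The squared norm of [dot v v *: u - dot u v *: v] is [dot v v] times the difference of the two
    sides. *)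
Lemma cauchy_schwarz u v : dot u v ^+ 2 <= dot u u * dot v v.
Proof.
have [v0|v0] := eqVneq (dot v v) 0.
  by rewrite (dot_eq0 v0) !dot0r mulr0 expr0n.
have := dot_ge0 (dot v v *: u - dot u v *: v); rewrite !dot_lin (dotC v u).
have vv : 0 < dot v v by rewrite lt_neqAle eq_sym v0 dot_ge0.
move=> h; rewrite -(ler_pM2l vv); nra.
Qed.

Lemma enorm_ge0 u : 0 <= enorm u.
Proof. exact: sqrtr_ge0. Qed.

Lemma sqr_enorm u : enorm u ^+ 2 = dot u u.
Proof. by rewrite sqr_sqrtr ?dot_ge0. Qed.

Lemma enorm_eq0 u : enorm u = 0 -> u = 0.
Proof. by move=> u0; apply: dot_eq0; rewrite -sqr_enorm u0 expr0n. Qed.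

Lemma enormZ c u : enorm (c *: u) = `|c| * enorm u.
Proof.
by rewrite /enorm dotZl dotZr mulrA -expr2 sqrtrM ?sqr_ge0 // sqrtr_sqr.
Qed.

Lemma dot_le_enorm u v : dot u v <= enorm u * enorm v.
Proof.
apply: le_trans (ler_norm _) _.
rewrite -(@ler_pXn2r _ 2) ?nnegrE ?mulr_ge0 ?enorm_ge0 ?normr_ge0 //.
by rewrite exprMn !sqr_enorm real_normK ?num_real // cauchy_schwarz.
Qed.

Lemma enormN u : enorm (- u) = enorm u.
Proof. by rewrite -scaleN1r enormZ normrN1 mul1r. Qed.

Lemma enormD u v : enorm (u + v) <= enorm u + enorm v.
Proof.
rewrite -(@ler_pXn2r _ 2) ?nnegrE ?addr_ge0 ?enorm_ge0 // sqrrD !sqr_enorm.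
by rewrite !dot_lin (dotC v u); have := dot_le_enorm u v; lra.
Qed.

Lemma usphereE u : usphere u <-> dot u u = 1.
Proof.
rewrite -sqr_enorm /usphere /=; split=> [->|]; first by rewrite expr1n.
by move/eqP; rewrite sqrp_eq1 ?enorm_ge0 // => /eqP.
Qed.

Lemma usphere_normalize u : u != 0 -> usphere ((enorm u)^-1 *: u).
Proof.
move=> u0; rewrite /usphere /= enormZ ger0_norm ?invr_ge0 ?enorm_ge0 //.
by rewrite mulVf //; apply: contra_neq u0; apply: enorm_eq0.
Qed.

Lemma usphere_neq0 u : usphere u -> u != 0.
Proof. by move/usphereE => u1; apply/eqP => u0; move: u1; rewrite u0 dot0l; lra. Qed.

Lemma usphere_nonempty : (0 < k)%N -> @usphere R k !=set0.
Proof.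
move=> k0; have : (const_mx 1 : 'cV[R]_k) != 0.
  apply/eqP => /colP /(_ (Ordinal k0)); rewrite !mxE; lra.
by move/usphere_normalize => ?; exists ((enorm (const_mx 1 : 'cV[R]_k))^-1 *: const_mx 1).
Qed.

Lemma coord_le_enorm u i : `|u i 0| <= enorm u.
Proof.
rewrite -(@ler_pXn2r _ 2) ?nnegrE ?enorm_ge0 ?normr_ge0 //.
rewrite sqr_enorm real_normK ?num_real // dotE (bigD1 i) //= -expr2 lerDl.
by apply: sumr_ge0 => j _; rewrite -expr2 sqr_ge0.
Qed.

Lemma dot_continuousr u : continuous (dot u : 'cV[R]_k -> R).
Proof.
rewrite (_ : dot u = fun v => \sum_i u i 0 * v i 0); last first.
  by apply/funext => v; rewrite dotE.
apply: (@continuous_big R) => [|i _ v]; first exact: add_continuous.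
by apply: continuousM; [exact: cst_continuous|exact: coord_continuous].
Qed.

Lemma dot_continuous_diag : continuous (fun u : 'cV[R]_k => dot u u : R).
Proof.
rewrite (_ : (fun u => dot u u) = fun v => \sum_i v i 0 * v i 0); last first.
  by apply/funext => v; rewrite dotE.
apply: (@continuous_big R) => [|i _ v]; first exact: add_continuous.
by apply: continuousM; exact: coord_continuous.
Qed.

Lemma enorm_continuous : continuous (@enorm R k).
Proof.
move=> u; apply: (@continuous_comp _ _ _ (fun v => dot v v) (@Num.sqrt R)).
  exact: dot_continuous_diag.
exact: sqrt_continuous.
Qed.

Lemma trmx_continuous : continuous (@trmx R 1 k).
Proof.
move=> u A /nbhs_ballP[e /= e0 eA]; apply/nbhs_ballP; exists e => //= v [_ uv].
by apply: eA; split => // i j; rewrite !mxE.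
Qed.

(** Tychonoff for segments is available on row vectors; transposition carries it to columns. *)
Lemma compact_enorm_le M : compact [set u : 'cV[R]_k | forall i, `|u i 0| <= M].
Proof.
rewrite (_ : mkset _ = trmx @`
    [set v : 'rV[R]_k | forall i, `[- M, M]%classic (v ord0 i)]).
  apply: continuous_compact.
    exact: (@continuous_subspaceT _ _ _ _ trmx_continuous).
  exact: (@rV_compact R k (fun=> `[- M, M]%classic)
    (fun=> @segment_compact R _ _)).
apply/seteqP; split => u /=.
  move=> h; exists u^T; last by rewrite trmxK.
  by move=> i; rewrite mxE /= in_itv /= -ler_norml.
move=> [v h <-] i; rewrite mxE; have := h i.
by rewrite /= in_itv /= -ler_norml.
Qed.

End Euclidean.

Lemma enorm_le (R : realType) (k l : nat) (u : 'cV[R]_k) (v : 'cV[R]_l) :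
  (enorm u <= enorm v) = (dot u u <= dot v v).
Proof. by rewrite -!sqr_enorm ler_pXn2r ?nnegrE ?enorm_ge0. Qed.

(** * The Lorentzian form on the product space *)

Section ProductSpace.
Variables (R : realType) (n m : nat).
Local Notation V := ('cV[R]_n * 'cV[R]_m)%type.
Implicit Types (p q v w z : V) (A B C K : set V).
Implicit Types (a : 'cV[R]_n) (d : 'cV[R]_m).

Definition lform p q : R := dot p.2 q.2 - dot p.1 q.1.

Lemma lformC p q : lform p q = lform q p.
Proof. by rewrite /lform dotC (dotC p.1). Qed.

Lemma lformDl p q v : lform (p + q) v = lform p v + lform q v.
Proof. by rewrite /lform /= !dot_lin; ring. Qed.

Lemma lformDr p q v : lform v (p + q) = lform v p + lform v q.
Proof. by rewrite /lform /= !dot_lin; ring. Qed.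

Lemma lformNl p v : lform (- p) v = - lform p v.
Proof. by rewrite /lform /= !dot_lin; ring. Qed.

Lemma lformNr p v : lform v (- p) = - lform v p.
Proof. by rewrite /lform /= !dot_lin; ring. Qed.

Lemma lformZl t p v : lform (t *: p) v = t * lform p v.
Proof. by rewrite /lform /= !dot_lin; ring. Qed.

Lemma lformZr t p v : lform v (t *: p) = t * lform v p.
Proof. by rewrite /lform /= !dot_lin; ring. Qed.

Lemma lform0l v : lform 0 v = 0.
Proof. by rewrite -(scale0r v) lformZl mul0r. Qed.

Lemma lform0r v : lform v 0 = 0.
Proof. by rewrite lformC lform0l. Qed.

Definition lform_lin := (lformDl, lformDr, lformNl, lformNr, lformZl, lformZr).

Lemma QhE p : Qh p <-> 0 <= lform p p.
Proof. by rewrite /Qh /= enorm_le /lform subr_ge0. Qed.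

Lemma lform_le0 p : (lform p p <= 0) = (enorm p.2 <= enorm p.1).
Proof. by rewrite enorm_le /lform subr_le0. Qed.

Definition linform a d p : R := dot a p.1 + dot d p.2.

Lemma linformD a d p q : linform a d (p + q) = linform a d p + linform a d q.
Proof. by rewrite /linform /= !dot_lin; ring. Qed.

Lemma linformN a d p : linform a d (- p) = - linform a d p.
Proof. by rewrite /linform /= !dot_lin; ring. Qed.

Lemma linformZ a d t p : linform a d (t *: p) = t * linform a d p.
Proof. by rewrite /linform /= !dot_lin; ring. Qed.

Lemma linform0 a d : linform a d 0 = 0.
Proof. by rewrite -(scale0r 0) linformZ mul0r. Qed.

Definition linform_lin := (linformD, linformN, linformZ).

Lemma linform_sum a d k (c : 'I_k -> R) (p : 'I_k -> V) :
  linform a d (\sum_i c i *: p i) = \sum_i c i * linform a d (p i).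
Proof.
elim/big_rec2: _ => [|i x y _ <-]; first exact: linform0.
by rewrite !linform_lin.
Qed.

Lemma hyperplaneE a d p : hyperplane a d p <-> linform a d p = -1.
Proof. by []. Qed.

Lemma linform_continuous a d : continuous (linform a d).
Proof.
have h1 : continuous (fun p : V => dot a p.1).
  move=> p; apply: (@continuous_comp _ _ _ fst (dot a)); first exact: cvg_fst.
  exact: dot_continuousr.
have h2 : continuous (fun p : V => dot d p.2).
  move=> p; apply: (@continuous_comp _ _ _ snd (dot d)); first exact: cvg_snd.
  exact: dot_continuousr.
by move=> p; exact: (continuousD (h1 p) (h2 p)).
Qed.

Lemma lform_continuousr p : continuous (lform p).
Proof.
rewrite (_ : lform p = linform (- p.1) p.2); first exact: linform_continuous.
by apply/funext => q; rewrite /linform /lform dotNl addrC.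
Qed.

Lemma lform_continuous_diag : continuous (fun p => lform p p).
Proof.
have h1 : continuous (fun p : V => dot p.1 p.1).
  move=> p; apply: (@continuous_comp _ _ _ fst (fun u => dot u u)).
    exact: cvg_fst.
  exact: dot_continuous_diag.
have h2 : continuous (fun p : V => dot p.2 p.2).
  move=> p; apply: (@continuous_comp _ _ _ snd (fun u => dot u u)).
    exact: cvg_snd.
  exact: dot_continuous_diag.
by move=> p; exact: (continuousB (h2 p) (h1 p)).
Qed.

Lemma closed_fun_le (f : V -> R) c : continuous f -> closed [set p | f p <= c].
Proof.
move=> fc; apply: (@preimage_closed _ _ f [set x | x <= c]) => [p _|].
  exact: fc.
exact: closed_le.
Qed.

Lemma closed_fun_ge (f : V -> R) c : continuous f -> closed [set p | c <= f p].
Proof.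
move=> fc; apply: (@preimage_closed _ _ f [set x | c <= x]) => [p _|].
  exact: fc.
exact: closed_ge.
Qed.

Lemma closed_fun_eq (f : V -> R) c : continuous f -> closed [set p | f p = c].
Proof.
move=> fc; apply: (@preimage_closed _ _ f [set x | x = c]) => [p _|].
  exact: fc.
exact: closed_eq.
Qed.

Lemma bounded_closed_EVT (A : set V) (M : R) (f : V -> R) :
  A !=set0 -> closed A -> (forall p, A p -> enorm p.1 <= M /\ enorm p.2 <= M) ->
  continuous f -> exists2 c, A c & forall p, A p -> f c <= f p.
Proof.
move=> A0 cA bA fc.
have kA : compact A.
  apply: (subclosed_compact cA
    (compact_setX (@compact_enorm_le R n M) (@compact_enorm_le R m M))).
  move=> p /bA[h1 h2]; split=> i /=; first exact: le_trans (coord_le_enorm _ _) h1.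
  exact: le_trans (coord_le_enorm _ _) h2.
have [c cA' h] := compact_EVT_min A0 kA (@continuous_subspaceT _ _ _ _ fc).
by exists c => [|p Ap]; [exact: set_mem|apply: h; exact: mem_set].
Qed.

Lemma nbhs_line A p v : nbhs p A ->
  exists2 e : R, 0 < e & forall s, 0 <= s <= e -> A (p + s *: v).
Proof.
move=> /nbhs_ballP[e /= e0 eA]; have v0 := normr_ge0 v.
exists (e / (`|v| + 1) / 2) => [|s /andP[s0 se]]; first by rewrite !divr_gt0 //; lra.
apply: eA; rewrite -ball_normE /ball_ /= opprD addrA subrr sub0r normrN normrZ.
rewrite ger0_norm //; apply: le_lt_trans (_ : e / (`|v| + 1) / 2 * `|v| < _).
  by rewrite ler_wpM2r.
have v1 : 0 < `|v| + 1 by lra.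
rewrite mulrAC ltr_pdivrMr // mulrAC ltr_pdivrMr //; nra.
Qed.

(** The homothety of ratio [t] sending [z] to [p] carries neighbourhoods of [z] to neighbourhoods of
    [p]. *)
Lemma nbhs_dilate A B z p t : nbhs z A -> 0 < t ->
  (forall v, A (z + v) -> B (p + t *: v)) -> nbhs p B.
Proof.
move=> /nbhs_ballP[e /= e0 eA] t0 h; apply/nbhs_ballP.
exists (t * e) => /= [|q]; first exact: mulr_gt0.
rewrite -ball_normE /ball_ /= => pq.
have -> : q = p + t *: (t^-1 *: (q - p)).
  by rewrite scalerA divff ?gt_eqF // scale1r addrC subrK.
apply: h; apply: eA; rewrite -ball_normE /ball_ /= opprD addrA subrr sub0r normrN.
by rewrite normrZ gtr0_norm ?invr_gt0 // distrC mulrC ltr_pdivrMr // mulrC.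
Qed.

End ProductSpace.

(** * Convex cones and affine hulls *)

Section Cones.
Variables (R : realType) (n m : nat).
Local Notation V := ('cV[R]_n * 'cV[R]_m)%type.
Implicit Types (p q v w z : V) (A B C K : set V).
Implicit Types (a : 'cV[R]_n) (d : 'cV[R]_m).

(** The empty set qualifies, so membership of 0 is stated separately. *)
Definition convex_cone C :=
  (forall p q, C p -> C q -> C (p + q)) /\
  (forall (t : R) p, 0 <= t -> C p -> C (t *: p)).

Lemma convex_cone_sum C k (f : 'I_k -> V) : convex_cone C -> C 0 ->
  (forall i, C (f i)) -> C (\sum_i f i).
Proof.
by move=> [CD _] C0 Cf; elim/big_ind: _ => // p q; exact: CD.
Qed.

Lemma coord_prodE v : v = \sum_i v.1 i 0 *: ((delta_mx i 0, 0) : V) +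
  \sum_j v.2 j 0 *: ((0, delta_mx j 0) : V).
Proof.
apply: injective_projections => /=; rewrite !raddf_sum /=.
  rewrite [X in _ + X]big1 => [|j _]; last by rewrite scaler0.
  rewrite addr0; apply/colP => i; rewrite summxE (bigD1 i) //= big1 => [|j ji].
    by rewrite !mxE !eqxx mulr1 addr0.
  by rewrite !mxE eq_sym (negbTE ji) mulr0.
rewrite [X in X + _]big1 => [|j _]; last by rewrite scaler0.
rewrite add0r; apply/colP => i; rewrite summxE (bigD1 i) //= big1 => [|j ji].
  by rewrite !mxE !eqxx mulr1 addr0.
by rewrite !mxE eq_sym (negbTE ji) mulr0.
Qed.

Lemma coord_le_norm k (u : 'cV[R]_k) i : `|u i 0| <= `|u|.
Proof.
rewrite [leRHS]/Num.norm /= mx_normrE; apply/bigmax_geP; right => /=.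
by exists (i, 0).
Qed.

(* If [e i = P i - Q i] with [P i] and [Q i] in the cone, then the cone contains the
   unit ball, for the sup norm, around the sum of all the [P i] and [Q i]. *)
Lemma convex_cone_interior C : convex_cone C -> C 0 ->
  (forall v, exists p q, [/\ C p, C q & v = p - q]) -> exists z, nbhs z C.
Proof.
move=> cC C0 gen; have [CD CZ] := cC.
have /choice[P /choice[Q PQ]] : forall v, exists p, exists q, [/\ C p, C q & v = p - q].
  exact: gen.
pose e1 i : V := (delta_mx i 0, 0); pose e2 j : V := (0, delta_mx j 0).
exists (\sum_i (P (e1 i) + Q (e1 i)) + \sum_j (P (e2 j) + Q (e2 j))).
apply/nbhs_ballP; exists 1 => //= w; rewrite -ball_normE /ball_ /= distrC.
set z := \sum_i _ + _; set v := w - z => v1.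
have -> : w = z + v by rewrite addrC subrK.
have in1 (c : R) x : `|c| <= 1 -> C (P x + Q x + c *: x).
  rewrite ler_norml => /andP[c1 c2]; have [CP CQ xE] := PQ x.
  rewrite {3}xE (_ : _ + _ = (1 + c) *: P x + (1 - c) *: Q x).
    by apply: CD; apply: CZ => //; lra.
  by rewrite scalerBr !scalerDl scaleNr !scale1r addrACA.
have nv1 i : `|v.1 i 0| <= 1.
  apply: le_trans (coord_le_norm _ _) _; apply: le_trans (ltW v1).
  by rewrite prod_normE /= le_max lexx.
have nv2 i : `|v.2 i 0| <= 1.
  apply: le_trans (coord_le_norm _ _) _; apply: le_trans (ltW v1).
  by rewrite prod_normE /= le_max lexx orbT.
rewrite [v]coord_prodE /z addrACA -!big_split /=.
by apply: CD; apply: convex_cone_sum => // i; exact: in1.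
Qed.

Lemma affine_hullS A B : A `<=` B -> affine_hull A `<=` affine_hull B.
Proof.
move=> AB p [k [f [c [Af c1 ->]]]]; exists k, f, c.
by split => // i; exact/AB.
Qed.

Lemma affine_hull_hyperplane a d K :
  K `<=` hyperplane a d -> affine_hull K `<=` hyperplane a d.
Proof.
move=> KH p [k [f [c [Af c1 ->]]]]; apply/hyperplaneE.
rewrite linform_sum (eq_bigr (fun i => - c i)) => [|i _].
  by rewrite sumrN c1.
by have /hyperplaneE -> := KH _ (Af i); rewrite mulrN1.
Qed.

Lemma dim_prod_cV : dim V = (n + m)%N.
Proof.
have dim_cV k : dim 'cV[R]_k = k by exact: muln1.
by rewrite -[RHS](congr2 addn (dim_cV n) (dim_cV m)).
Qed.

(** * Sets of full dimension in the hyperplane *)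

Section FullDimHyperplane.
Variables (a : 'cV[R]_n) (d : 'cV[R]_m) (K : set V).
Hypotheses (nm : (0 < n + m)%N) (KH : K `<=` hyperplane a d).
Hypothesis Kdim : full_dimensional_in_hyperplane K.

(** The direction space of the affine hull has codimension one and lies in the kernel of
    [linform a d], whereas [linform a d x = -1]; hence it is complementary to the line of [x]. *)
Lemma full_dim_decomp : exists2 x, affine_hull K x &
  forall v, exists u c, [/\ affine_hull K (x + u), linform a d u = 0 & v = u + c *: x].
Proof.
have [x [U [KE dU]]] := Kdim.
have Kx : affine_hull K x by rewrite KE /= subrr mem0v.
have Lx := affine_hull_hyperplane KH Kx.
have KU u : u \in U -> affine_hull K (x + u) by rewrite KE /= addrC addKr.
have LU u : u \in U -> linform a d u = 0.
  move=> /KU/(affine_hull_hyperplane KH)/hyperplaneE; rewrite linformD.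
  by move: Lx => /hyperplaneE ->; lra.
exists x => // v.
have x0 : x != 0.
  by apply/eqP => x0; move: Lx => /hyperplaneE; rewrite x0 linform0; lra.
have UX : (U + <[x]> = fullv)%VS.
  apply/eqP; rewrite eqEdim subvf dimvf dimv_disjoint_sum.
    by rewrite dU dim_vline x0 /= subnK // dim_prod_cV.
  apply/eqP; rewrite -subv0; apply/subvP => w; rewrite memv_cap memv0.
  move=> /andP[/LU Lw /vlineP[c wE]]; move: Lw.
  rewrite wE linformZ; move: Lx => /hyperplaneE -> c0.
  by rewrite (_ : c = 0) ?scale0r //; lra.
have : v \in (U + <[x]>)%VS by rewrite UX memvf.
move=> /memv_addP[u uU [w /vlineP[c ->] ->]].
by exists u, c; split; [exact: KU|exact: LU|].
Qed.

Lemma full_dim_affine_hull : affine_hull K = hyperplane a d.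
Proof.
apply/seteqP; split; first exact: affine_hull_hyperplane.
have [x Kx dec] := full_dim_decomp => v /hyperplaneE Lv.
have [u [c [Ku Lu vE]]] := dec v.
have /hyperplaneE Lx := affine_hull_hyperplane KH Kx.
suff c1 : c = 1 by rewrite vE c1 scale1r addrC.
by move: Lv; rewrite vE linformD linformZ Lx Lu; lra.
Qed.

(** The differences of elements of [C] form a linear subspace; it contains the affine hull of [K],
    hence both terms of [full_dim_decomp]. *)
Lemma full_dim_cone_gen C : convex_cone C -> C 0 -> K `<=` C ->
  forall v, exists p q, [/\ C p, C q & v = p - q].
Proof.
move=> [CD CZ] C0 KC.
pose S v := exists p q, [/\ C p, C q & v = p - q].
have SD u v : S u -> S v -> S (u + v).
  move=> [p [q [Cp Cq ->]]] [p' [q' [Cp' Cq' ->]]].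
  by exists (p + p'), (q + q'); split; [exact: CD|exact: CD|rewrite opprD addrACA].
have SZ c v : S v -> S (c *: v).
  move=> [p [q [Cp Cq ->]]]; have [c0|c0] := leP 0 c.
    by exists (c *: p), (c *: q); split; [exact: CZ|exact: CZ|rewrite scalerBr].
  exists ((- c) *: q), ((- c) *: p); split; [apply: CZ => //; lra|apply: CZ => //; lra|].
  by rewrite scalerBr !scaleNr opprK addrC.
have S0 : S 0 by exists 0, 0; rewrite subr0.
have SK v : affine_hull K v -> S v.
  move=> [k [f [c [Kf _ ->]]]]; elim/big_ind: _ => // i _; apply: SZ.
  by exists (f i), 0; split; [exact: KC| |rewrite subr0].
have [x Kx dec] := full_dim_decomp => v; have [u [c [Ku _ ->]]] := dec v.
rewrite (_ : u + _ = (x + u) + (c - 1) *: x); last first.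
  by rewrite scalerBl scale1r (addrC x) addrACA subrr addr0.
by apply: SD; [exact: SK|apply/SZ/SK].
Qed.

Lemma full_dim_in_hyperplaneS K' : K `<=` K' -> K' `<=` hyperplane a d ->
  full_dimensional_in_hyperplane K' /\ affine_hull K' = hyperplane a d.
Proof.
move=> KK' K'H.
have E : affine_hull K' = hyperplane a d.
  apply/seteqP; split; first exact: affine_hull_hyperplane.
  by rewrite -full_dim_affine_hull; exact: affine_hullS.
by split => //; rewrite /full_dimensional_in_hyperplane /has_dim E -full_dim_affine_hull.
Qed.

Lemma full_dim_cone C : convex_cone C -> C 0 -> K `<=` C -> full_dimensional C.
Proof.
move=> cC C0 KC; exists 0, fullv; split; last by rewrite dimvf dim_prod_cV.
apply/seteqP; split => v /=; rewrite subr0 memvf // => _.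
have [p [q [Cp Cq ->]]] := full_dim_cone_gen cC C0 KC v.
(* The point 0 only serves to bring the sum of the coefficients to 1. *)
exists 3%N, (fun i : 'I_3 => [:: p; q; 0]`_i), (fun i : 'I_3 => [:: 1; -1; 1]`_i).
split; first by case=> -[|[|[|//]]].
  by rewrite !big_ord_recl big_ord0 /=; lra.
by rewrite !big_ord_recl big_ord0 /= scale1r scaleN1r scaler0 !addr0.
Qed.

End FullDimHyperplane.

End Cones.

(** * The cone over a [Qg]-free set *)

Section FreeToCone.
Variables (R : realType) (n m : nat).
Local Notation V := ('cV[R]_n * 'cV[R]_m)%type.
Implicit Types (p q v w z : V) (A B C K : set V).
Implicit Types (a : 'cV[R]_n) (d : 'cV[R]_m).

Lemma convex_set_comb K p q (t : R) : convex_set K -> K p -> K q ->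
  0 <= t <= 1 -> K (t *: p + (1 - t) *: q).
Proof.
move=> cK Kp Kq /andP[t0 t1].
by have := cK p q (Itv01 t0 t1) (mem_set Kp) (mem_set Kq); rewrite inE.
Qed.

Lemma comb_convex_set K : (forall p q (t : R), K p -> K q -> 0 <= t <= 1 ->
  K (t *: p + (1 - t) *: q)) -> convex_set K.
Proof.
move=> h p q l /set_mem Kp /set_mem Kq; apply/mem_set/h => //.
by apply/andP; split.
Qed.

Definition cone_of K : set V :=
  [set p | exists (t : R) (k : V), [/\ 0 <= t, K k & p = t *: k]].

Lemma cone_of_sub K : K `<=` cone_of K.
Proof. by move=> k Kk; exists 1, k; rewrite scale1r; split. Qed.

Lemma cone_of0 K : K !=set0 -> cone_of K 0.
Proof. by move=> [k Kk]; exists 0, k; rewrite scale0r; split. Qed.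

Lemma cone_of_convex K : convex_set K -> convex_cone (cone_of K).
Proof.
move=> cK; split=> [_ _ [t [k [t0 Kk ->]]] [s [l [s0 Kl ->]]]|]; last first.
  move=> s _ s0 [t [k [t0 Kk ->]]]; exists (s * t), k.
  by rewrite scalerA mulr_ge0.
have [ts|ts] := eqVneq (t + s) 0.
  have [-> ->] : t = 0 /\ s = 0 by split; lra.
  by exists 0, k; rewrite !scale0r addr0.
have ts0 : 0 < t + s by rewrite lt_neqAle eq_sym ts addr_ge0.
exists (t + s), ((t / (t + s)) *: k + (1 - t / (t + s)) *: l); split.
- exact: ltW.
- by apply: convex_set_comb; rewrite // divr_ge0 ?(ltW ts0) //= ler_pdivrMr //; lra.
- rewrite scalerDr !scalerA; congr (_ *: _ + _ *: _); by field.
Qed.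

Section Free.
Variables (a : 'cV[R]_n) (d : 'cV[R]_m) (K : set V).
Hypotheses (nm : (0 < n + m)%N) (Kfree : Qg_free a d K).

Let KH : K `<=` hyperplane a d. Proof. by case: Kfree. Qed.
Let Kdim : full_dimensional_in_hyperplane K. Proof. by case: Kfree. Qed.
Let Kconv : convex_set K. Proof. by case: Kfree. Qed.

Lemma free_nonempty : K !=set0.
Proof.
have [x [k [f [c [Kf c1 _]]]] _] := full_dim_decomp nm KH Kdim.
case: k f c Kf c1 => [|k] f c Kf; last by exists (f ord0).
by rewrite big_ord0 => /eqP; rewrite eq_sym oner_eq0.
Qed.

Lemma cone_of_hyperplane p : cone_of K p -> hyperplane a d p -> K p.
Proof.
move=> [t [k [t0 Kk ->]]] /hyperplaneE; rewrite linformZ.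
have /hyperplaneE -> := KH Kk => t1.
by rewrite (_ : t = 1) ?scale1r //; lra.
Qed.

(** An interior point [t *: k] of the cone is rescaled to [k]. Here [t] cannot vanish: [linform a d]
    is nonpositive on the cone but positive at small multiples of [- k], so 0 is not interior. *)
Lemma cone_of_interior : exists2 z, K z & nbhs z (cone_of K).
Proof.
have C0 := cone_of0 free_nonempty; have cC := cone_of_convex Kconv.
have [z zC] := convex_cone_interior cC C0
  (full_dim_cone_gen nm KH Kdim cC C0 (@cone_of_sub K)).
have [t [k [t0 Kk zE]]] := nbhs_singleton zC.
have /hyperplaneE Lk := KH Kk.
have tgt0 : 0 < t.
  rewrite lt_neqAle t0 andbT; apply/eqP => te; move: zC.
  rewrite zE -te scale0r => /(@nbhs_line _ _ _ _ _ (- k))[e e0 /(_ e)].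
  rewrite lexx ltW // => /(_ isT)[s [l [s0 Kl /(congr1 (linform a d))]]].
  have /hyperplaneE Ll := KH Kl.
  by rewrite !linform_lin linform0 Lk Ll; lra.
exists k => //; have ti0 : 0 < t^-1 by rewrite invr_gt0.
apply: (nbhs_dilate zC ti0) => v.
rewrite zE => /(cC.2 t^-1 _ (ltW ti0)).
by rewrite scalerDr scalerA mulVf ?gt_eqF // scale1r.
Qed.

(** Shrinking a neighbourhood of [z] towards [k] keeps it in the cone, and the points of the cone on
    the hyperplane belong to [K]. *)
Lemma relint_comb z k (t : R) : K z -> nbhs z (cone_of K) -> K k ->
  0 < t <= 1 -> relint K (k + t *: (z - k)).
Proof.
move=> Kz zC Kk /andP[t0 t1].
have [CD CZ] := cone_of_convex Kconv.
have comb : k + t *: (z - k) = t *: z + (1 - t) *: k.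
  by rewrite scalerBl scale1r scalerBr addrCA.
split; first by rewrite comb; apply: convex_set_comb => //; rewrite t1 ltW.
apply: (nbhs_dilate zC t0) => v Cv /(affine_hull_hyperplane KH) h.
apply: cone_of_hyperplane h; rewrite comb addrAC -scalerDr.
apply: CD; apply: CZ => //; [exact: ltW|lra|exact: cone_of_sub].
Qed.

(** If the form were positive at some [k] in [K], it would stay positive slightly further towards
    [z], at a point of the relative interior that then lies in [Qg]. *)
Lemma free_lform_le0 p : cone_of K p -> lform p p <= 0.
Proof.
move=> [s [k [s0 Kk ->]]]; rewrite lformZl lformZr mulrA -expr2.
apply: mulr_ge0_le0; first exact: sqr_ge0.
rewrite leNgt; apply/negP => k0; have [z Kz zC] := cone_of_interior.
have rw := relint_comb Kz zC Kk; move: rw; set u := z - k => rw.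
set b := lform k u; set c := lform u u.
(* For [t <= 1] the form at [k + t *: u] is at least [lform k k - t * (2 * |b| + |c|)], and
   [t * D = lform k k] turns this bound into [t * lform k k]. *)
pose D := lform k k + 2 * `|b| + `|c|.
have D0 : 0 < D by rewrite /D; have := normr_ge0 b; have := normr_ge0 c; lra.
pose t := lform k k / D.
have tD : t * D = lform k k by rewrite /t divfK ?gt_eqF.
have t0 : 0 < t by rewrite divr_gt0.
have t1 : t <= 1.
  by rewrite ler_pdivrMr // mul1r /D; have := normr_ge0 b; have := normr_ge0 c; lra.
have {}rw := rw t (introT andP (conj t0 t1)).
case: Kfree => _ _ _ _; rewrite -subset0 => /(_ (k + t *: u)); apply.
split => //; split; last exact: KH rw.1.
apply/QhE; rewrite lformDl !lformDr !(lformZl, lformZr) (lformC u k) -/b -/c.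
have := ler_norm (- b); have := ler_norm (- c); rewrite !normrN /D in tD *.
have := normr_ge0 b; have := normr_ge0 c; nra.
Qed.

End Free.
End FreeToCone.

(** * Maximal cones on which the form is nonpositive *)

Section Separation.
Variables (R : realType) (n m : nat).
Local Notation V := ('cV[R]_n * 'cV[R]_m)%type.
Implicit Types (p q v w z : V) (A B C K : set V).

Lemma maximal_lform_cone C0 : convex_cone C0 -> C0 0 ->
    (forall p, C0 p -> lform p p <= 0) ->
  exists C, [/\ C0 `<=` C, convex_cone C, forall p, C p -> lform p p <= 0 &
    forall w, (forall p, C p -> lform (p + w) (p + w) <= 0) -> C w].
Proof.
move=> cC0 C00 nC0.
(* Taking the union with [C0] makes the empty set admissible, as the empty chain requires. *)
pose P (X : set V) := convex_cone (C0 `|` X) /\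
  forall p, (C0 `|` X) p -> lform p p <= 0.
have [F FP totF|A [[[AD AZ] nA] maxA]] := @Zorn_bigcup _ P.
  have up X p : F X -> (C0 `|` X) p -> (C0 `|` \bigcup_(X in F) X) p.
    by move=> FX [?|?]; [left|right; exists X].
  have dn p : (C0 `|` \bigcup_(X in F) X) p -> C0 p \/ exists2 X, F X & X p.
    by move=> [?|[X FX Xp]]; [left|right; exists X].
  split; first split.
  - move=> p q /dn[C0p|[X FX Xp]] /dn[C0q|[Y FY Yq]].
    + by left; exact: cC0.1.
    + by apply: (up Y) => //; apply: (FP _ FY).1.1; [left|right].
    + by apply: (up X) => //; apply: (FP _ FX).1.1; [right|left].
    + have [XY|YX] := totF _ _ FX FY.
        by apply: (up Y) => //; apply: (FP _ FY).1.1; right => //; exact: XY.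
      by apply: (up X) => //; apply: (FP _ FX).1.1; right => //; exact: YX.
  - move=> t p t0 /dn[C0p|[X FX Xp]]; first by left; exact: cC0.2.
    by apply: (up X) => //; apply: (FP _ FX).1.2 => //; right.
  - by move=> p /dn[/nC0//|[X FX Xp]]; apply: (FP _ FX).2; right.
exists (C0 `|` A); split => // w hw; apply: contrapT => nw.
(* The cone generated by the candidate and [w]. By homogeneity the form at [p + t *: w] has the sign
   of the form at [t^-1 *: p + w], so the hypothesis on [w] covers every positive [t]. *)
pose B := [set q | exists p (t : R), [/\ (C0 `|` A) p, 0 <= t & q = p + t *: w]].
have CB : (C0 `|` A) `<=` B.
  by move=> p Ap; exists p, 0; rewrite scale0r addr0.
have CBE : C0 `|` B = B.
  by apply/seteqP; split=> p; [case=> // C0p; apply: CB; left|right].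
apply: (maxA B); first split.
- by move=> p Ap; apply: CB; right.
- move=> /(_ w) h; apply: nw; right; apply: h.
  by exists 0, 1; rewrite scale1r add0r; split => //; left.
rewrite /P CBE; split; first split.
- move=> _ _ [p [t [Ap t0 ->]]] [q [s [Aq s0 ->]]].
  exists (p + q), (t + s); split; [exact: AD|exact: addr_ge0|].
  by rewrite scalerDl addrACA.
- move=> s _ s0 [p [t [Ap t0 ->]]]; exists (s *: p), (s * t).
  by split; [exact: AZ|exact: mulr_ge0|rewrite scalerDr scalerA].
- move=> _ [p [t [Ap t0 ->]]].
  have [->|tn0] := eqVneq t 0; first by rewrite scale0r addr0; exact: nA.
  have tp : 0 < t by rewrite lt_neqAle eq_sym tn0.
  rewrite (_ : p + _ = t *: (t^-1 *: p + w)); last first.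
    by rewrite scalerDr scalerA divff // scale1r.
  rewrite lformZl lformZr mulrA -expr2; apply: mulr_ge0_le0; first exact: sqr_ge0.
  by apply: hw; apply: AZ => //; rewrite invr_ge0.
Qed.

Section MaximalCone.
Variables (C : set V) (z : V).
Hypotheses (coneC : convex_cone C) (C0 : C 0) (Cle0 : forall p, C p -> lform p p <= 0).
Hypothesis Cmax : forall w, (forall p, C p -> lform (p + w) (p + w) <= 0) -> C w.
Hypothesis zC : nbhs z C.

(** Maximality presents [C] as an intersection of sublevel sets of continuous functions, one for
    each of its elements. *)
Lemma maximal_cone_closed : closed C.
Proof.
rewrite (_ : C = \bigcap_(p in C) [set w | lform (p + w) (p + w) <= 0]).
  apply: closed_bigI => p _; apply: closed_fun_le => w.
  apply: (@continuous_comp _ _ _ (fun w => p + w) (fun v => lform v v)).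
    by apply: continuousD; [exact: cst_continuous|exact: cvg_id].
  exact: lform_continuous_diag.
apply/seteqP; split=> w; last by move=> h; apply: Cmax => p /h.
by move=> Cw p Cp; apply: Cle0; exact: coneC.1.
Qed.

Variable b : 'cV[R]_m.
Hypothesis b1 : usphere b.

Let dotb p : C p -> dot b p.2 <= enorm p.1.
Proof.
move=> /Cle0; rewrite lform_le0; apply: le_trans.
by apply: le_trans (dot_le_enorm _ _) _; rewrite b1 mul1r.
Qed.

(** Ensures that the Euclidean norm is differentiable at [z.1 + p.1]. If this vector were zero,
    nonpositivity of the form would force [z.2 + s *: b + p.2 = 0] for all small [s], which fails
    for two distinct values of [s]. *)
Lemma maximal_cone_opp_interior p : C p -> z.1 + p.1 != 0.
Proof.
move=> Cp; apply/eqP => zp0.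
have /(nbhs_line (0, b))[e e0 h] := zC.
have Ce s : 0 <= s <= e -> dot (z.2 + s *: b + p.2) (z.2 + s *: b + p.2) <= 0.
  move=> /h Cs; have := Cle0 (coneC.1 _ _ Cs Cp).
  by rewrite /lform /= scaler0 addr0 zp0 dot0l subr0.
have eq0 s : 0 <= s <= e -> z.2 + s *: b + p.2 = 0.
  by move=> /Ce hs; apply: dot_eq0; apply/eqP; rewrite eq_le hs dot_ge0.
have := eq0 e; rewrite lexx ltW // => /(_ isT).
have := eq0 0; rewrite lexx ltW // => /(_ isT).
rewrite scale0r addr0 addrAC => ->; rewrite add0r => /eqP.
by rewrite scaler_eq0 gt_eqF //= (negbTE (usphere_neq0 b1)).
Qed.

(* [g] is the gradient of the norm at [z.1 + c.1], where [c] minimizes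
   [enorm (z.1 + p.1) - (1 - e) * dot b p.2] over the cone: this function is
   coercive there thanks to [e > 0]. *)
Lemma approx_separation e : 0 < e < 1 ->
  exists2 g : 'cV[R]_n, usphere g & forall p, C p -> lform (g, (1 - e) *: b) p <= 0.
Proof.
move=> /andP[e0 e1].
pose phi p := enorm (z.1 + p.1) - (1 - e) * dot b p.2.
have phic : continuous phi.
  have h1 : continuous (fun p : V => enorm (z.1 + p.1)).
    move=> p; apply: (@continuous_comp _ _ _ (fun p : V => z.1 + p.1) (@enorm R n)).
      by apply: continuousD; [exact: cst_continuous|exact: cvg_fst].
    exact: enorm_continuous.
  have h2 : continuous (fun p : V => (1 - e) * dot b p.2).
    rewrite (_ : (fun p : V => _) = linform 0 ((1 - e) *: b)).
      exact: linform_continuous.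
    by apply/funext => p; rewrite /linform dot0l add0r dotZl.
  by move=> p; exact: (continuousB (h1 p) (h2 p)).
pose A := C `&` [set p | phi p <= enorm z.1].
have phi0 : phi 0 = enorm z.1 by rewrite /phi /= addr0 dot0r mulr0 subr0.
have A0 : A 0 by split => //=; rewrite phi0.
have cA : closed A.
  by apply: closedI; [exact: maximal_cone_closed|exact: closed_fun_le].
(* On [A], [|p.1| <= |z.1 + p.1| + |z.1| <= 2 |z.1| + (1 - e) |p.1|], which gives the radius. *)
have [|c [Cc _] cmin] := @bounded_closed_EVT _ _ _ A (2 * enorm z.1 / e) phi
    (ex_intro _ _ A0) cA _ phic.
  move=> p [Cp pz].
  have p21 : enorm p.2 <= enorm p.1 by rewrite -lform_le0 Cle0.
  suff p1 : enorm p.1 <= 2 * enorm z.1 / e by split => //; exact: le_trans p1.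
  have := enormD (z.1 + p.1) (- z.1); rewrite enormN addrAC subrr add0r.
  move: pz; rewrite /phi /= ler_pdivlMr //.
  have := dotb Cp; nra.
have {}cmin p : C p -> phi c <= phi p.
  move=> Cp; have [pz|/ltW pz] := leP (phi p) (enorm z.1); first exact: cmin.
  by apply: le_trans pz; rewrite -phi0; exact: cmin.
have [u uE] : exists u, u = z.1 + c.1 by exists (z.1 + c.1).
have u0 : u != 0 by rewrite uE; exact: maximal_cone_opp_interior.
have N0 : 0 < enorm u.
  by rewrite lt_neqAle enorm_ge0 andbT eq_sym; apply: contra_neq u0; exact: enorm_eq0.
exists ((enorm u)^-1 *: u); first exact: usphere_normalize.
move=> p Cp; rewrite /lform /= !dotZl subr_le0.
suff h : 2 * enorm u * ((1 - e) * dot b p.2) <= 2 * dot u p.1.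
  by rewrite ler_pdivlMl //; nra.
(* First-order optimality along [c + t *: p]. The inequality [2 N (N' - N) <= N' ^ 2 - N ^ 2]
   replaces differentiation of the norm; dividing by [t] leaves an error term linear in [t]. *)
have ht t : 0 < t ->
    2 * enorm u * ((1 - e) * dot b p.2) <= 2 * dot u p.1 + t * dot p.1 p.1.
  move=> t0; have := cmin _ (coneC.1 _ _ Cc (coneC.2 _ _ (ltW t0) Cp)).
  rewrite /phi /= addrA -uE !dot_lin.
  have := sqr_enorm (u + t *: p.1); rewrite !dot_lin (dotC p.1 u) -(sqr_enorm u).
  set N' := enorm (u + _); set N := enorm u in N0 *.
  have : 0 <= (N' - N) ^+ 2 by exact: sqr_ge0.
  move=> h1 h2 h3; rewrite -(ler_pM2l t0).
  have : 2 * N * (t * ((1 - e) * dot b p.2)) <= 2 * N * (N' - N).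
    by apply: ler_wpM2l; [rewrite mulr_ge0 // ltW|lra].
  nra.
rewrite leNgt; apply/negP => lt.
have pp := dot_ge0 p.1.
set X := 2 * enorm u * _ in ht lt *; set Y := 2 * dot u p.1 in ht lt *.
have D0 : 0 < dot p.1 p.1 + 1 by lra.
(* In place of a limit at 0: for this [t] the error term stays below [X - Y]. *)
have := ht ((X - Y) / (dot p.1 p.1 + 1)).
rewrite divr_gt0 ?subr_gt0 // => /(_ isT).
rewrite mulrAC -lerBlDl ler_pdivlMr //; nra.
Qed.

(** Limit of [approx_separation] as [e] tends to 0. The separating vectors form a compact set [A];
    maximizing [dot b q.2] over it gives at least [1 - e] for every [e], hence at least 1, and
    [|q.2| <= 1] then forces [q.2 = b]. *)
Lemma separation : exists g : 'cV[R]_n,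
  [/\ usphere g, C (g, b) & forall p, C p -> lform (g, b) p <= 0].
Proof.
pose A : set V := [set q | dot q.1 q.1 = 1] `&` [set q | dot q.2 q.2 <= 1] `&`
  \bigcap_(p in C) [set q | lform p q <= 0].
have bb : dot b b = 1 by apply/usphereE.
have Ae e : 0 < e < 1 -> exists2 g : 'cV[R]_n, A (g, (1 - e) *: b) & True.
  move=> e01; have [g /usphereE g1 h] := approx_separation e01; exists g => //.
  split; first by split=> //=; rewrite !dot_lin bb; move/andP: e01 => []; nra.
  by move=> p /h; rewrite lformC.
have cA : closed A.
  apply: closedI; first apply: closedI.
  - apply: closed_fun_eq => p.
    apply: (@continuous_comp _ _ _ fst (fun u => dot u u)); first exact: cvg_fst.
    exact: dot_continuous_diag.
  - apply: closed_fun_le => p.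
    apply: (@continuous_comp _ _ _ snd (fun u => dot u u)); first exact: cvg_snd.
    exact: dot_continuous_diag.
  - by apply: closed_bigI => p _; apply: closed_fun_le; exact: lform_continuousr.
have A0 : A !=set0.
  have [|g Ag _] := Ae 2^-1; first by lra.
  by eexists; exact: Ag.
have bA p : A p -> enorm p.1 <= 1 /\ enorm p.2 <= 1.
  move=> [[/= h1 h2] _]; rewrite -b1 !enorm_le bb h1; split => //.
have [q [[/= q1 q2] qC] qmin] :=
  bounded_closed_EVT A0 cA bA (@linform_continuous R n m 0 (- b)).
have bqe e : 0 < e < 1 -> 1 - e <= dot b q.2.
  move=> /Ae[g Ag _]; have := qmin _ Ag.
  by rewrite /linform /= !dot0l !add0r !dotNl lerN2 dotZr bb mulr1.
have bq : 1 <= dot b q.2.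
  rewrite leNgt; apply/negP => lt1; have := bqe 2^-1; have := bqe ((1 - dot b q.2) / 2).
  lra.
have qb : q.2 = b.
  apply/eqP; rewrite -subr_eq0; apply/eqP/dot_eq0/eqP; rewrite eq_le dot_ge0 andbT.
  rewrite !dot_lin (dotC q.2 b) bb; lra.
exists q.1; rewrite -qb -surjective_pairing; split.
- by apply/usphereE.
(* As [q] is null, the form at [p + q] is [lform p p + 2 * lform q p], a sum of nonpositive
   terms. *)
- apply: Cmax => p Cp; rewrite lformDl !lformDr (lformC q p).
  have := Cle0 Cp; have := qC _ Cp => /=.
  by rewrite (_ : lform q q = 0) ?/lform ?qb ?bb ?q1 ?subrr //; lra.
- by move=> p /qC; rewrite lformC.
Qed.

End MaximalCone.
End Separation.

(** * Maximality of [C_Gamma] *)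

Section CsetMaximal.
Variables (R : realType) (n m : nat).
Local Notation V := ('cV[R]_n * 'cV[R]_m)%type.
Implicit Types (p q v w z : V) (A B C K : set V).
Implicit Types (b : 'cV[R]_m) (I : set 'cV[R]_m).

Lemma nbhs_convex C z p (t : R) : convex_set C -> nbhs z C -> C p ->
  0 < t <= 1 -> nbhs (p + t *: (z - p)) C.
Proof.
move=> cC zC Cp /andP[t0 t1]; apply: (nbhs_dilate zC t0) => v Czv.
rewrite (_ : _ + _ = t *: (z + v) + (1 - t) *: p).
  by apply: convex_set_comb => //; rewrite t1 ltW.
by rewrite scalerBl scale1r scalerBr scalerDr [RHS]addrCA -[LHS]addrA (addrAC (t *: z)).
Qed.

Variable Gamma : 'cV[R]_m -> 'cV[R]_n.

Lemma CsetE I p :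
  Cset Gamma I p <-> forall b, I b -> lform (Gamma b, b) p <= 0.
Proof. by split=> h b /h; rewrite /lform /= addrC. Qed.

Lemma Cset_cone I : convex_cone (Cset Gamma I).
Proof.
split=> [p q /CsetE Cp /CsetE Cq|t p t0 /CsetE Cp]; apply/CsetE => b Ib.
  by rewrite lformDr; have := Cp b Ib; have := Cq b Ib; lra.
by rewrite lformZr; apply: mulr_ge0_le0 => //; exact: Cp.
Qed.

Lemma Cset0 I : Cset Gamma I 0.
Proof. by apply/CsetE => b _; rewrite lform0r. Qed.

Lemma Cset_convex I : convex_set (Cset Gamma I).
Proof.
apply: comb_convex_set => p q t Cp Cq /andP[t0 t1]; have [CD CZ] := Cset_cone I.
by apply: CD; apply: CZ => //; lra.
Qed.

Lemma Cset_closed I : closed (Cset Gamma I).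
Proof.
rewrite (_ : Cset Gamma I = \bigcap_(b in I) [set p | lform (Gamma b, b) p <= 0]).
  by apply: closed_bigI => b _; apply: closed_fun_le; exact: lform_continuousr.
by apply/seteqP; split=> p; [move=> /CsetE h b /h|move=> h; apply/CsetE => b /h].
Qed.

Hypothesis Gamma1 : forall b, usphere b -> usphere (Gamma b).

Lemma lform_null b : usphere b -> lform (Gamma b, b) (Gamma b, b) = 0.
Proof.
move=> b1; have /usphereE := b1; have /usphereE := Gamma1 b1.
by rewrite /lform /= => -> ->; rewrite subrr.
Qed.

(** The form with [(Gamma b, b)] takes the value 2 in the direction [(- Gamma b, b)], so a
    constraint tight at [z] would be violated nearby. *)
Lemma Cset_interior_lt z b I : nbhs z (Cset Gamma I) -> I b -> usphere b ->
  lform (Gamma b, b) z < 0.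
Proof.
move=> /(@nbhs_line _ _ _ _ _ (- Gamma b, b))[e e0 h] Ib b1.
have := h e; rewrite lexx ltW // => /(_ isT)/CsetE/(_ b Ib).
rewrite lformDr lformZr {2}/lform /= dotNr.
by have /usphereE -> := b1; have /usphereE -> := Gamma1 b1; lra.
Qed.

Hypothesis m0 : (0 < m)%N.

(* Every point of [Qh] lies on one of the convex cones
   [{(x, t b) : |x| <= t}], [b] in the sphere, which [Cset] separates. *)
Lemma Qh_direction p : Qh p -> exists2 b, usphere b &
  p.2 = enorm p.2 *: b /\ 0 <= lform (Gamma b, b) p.
Proof.
rewrite /Qh /= => p12.
have [b b1 bE] : exists2 b, usphere b & p.2 = enorm p.2 *: b.
  have [p20|p20] := eqVneq p.2 0.
    have [b b1] := @usphere_nonempty R m m0; exists b => //.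
    by rewrite p20 /enorm dot0l sqrtr0 scale0r.
  exists ((enorm p.2)^-1 *: p.2); first exact: usphere_normalize.
  rewrite scalerA divff ?scale1r //.
  by apply: contra_neq p20; exact: enorm_eq0.
exists b => //; split => //; rewrite /lform /= bE dotZr.
have /usphereE -> := b1; have := dot_le_enorm (Gamma b) p.1.
by have -> := Gamma1 b1; lra.
Qed.

Lemma Cset_Qh_free : Qh_free (Cset Gamma (@usphere R m)).
Proof.
split; [exact: Cset_closed|exact: Cset_convex|].
rewrite -subset0 => p [pC /Qh_direction[b b1 [_ fp]]].
by have := Cset_interior_lt pC b1 b1; lra.
Qed.

Hypothesis Gamma_lip : forall b c, usphere b -> usphere c ->
  lform (Gamma b, b) (Gamma c, c) <= 0.
Variable z : V.
Hypothesis zC : nbhs z (Cset Gamma (@usphere R m)).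

(* The boundary point [(Gamma b, b)] of [Qh] belongs to [Cset]; relaxing the
   constraint of index [b] there lets the interior meet [Qh]. *)
Lemma Cset_maximal_Qh_free : maximal_Qh_free (Cset Gamma (@usphere R m)).
Proof.
split; first exact: Cset_Qh_free.
move=> [C' [[_ cC' fC'] [CC' C'C]]]; apply: C'C => p C'p; apply/CsetE => b b1.
rewrite leNgt; apply/negP => fp.
set Q : V := (Gamma b, b) in fp *.
have fz : lform Q z < 0 := Cset_interior_lt zC b1 b1.
have C'Q : C' Q by apply: CC'; apply/CsetE => c c1; exact: Gamma_lip.
have zC' : nbhs z C' by apply: filterS zC.
(* With this [t] the form with [Q] at [r] is half its value at [p]: [r] is interior to [C'] and
   still violates the constraint. *)
pose t := lform Q p / (lform Q p - lform Q z) / 2.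
have t01 : 0 < t <= 1.
  rewrite /t; apply/andP; split; first by rewrite !divr_gt0 //; lra.
  rewrite ler_pdivrMr // ler_pdivrMr; lra.
have [r rE] : exists r, r = p + t *: (z - p) by exists (p + t *: (z - p)).
have rC' : nbhs r C' by rewrite rE; exact: nbhs_convex.
have fr : 0 < lform Q r.
  have : t * (lform Q p - lform Q z) = lform Q p / 2.
    by rewrite /t mulrAC divfK //; apply/eqP; lra.
  by rewrite rE !lform_lin; lra.
have [u uE] : exists u, u = r - Q by exists (r - Q).
have fu : lform Q u = lform Q r by rewrite uE !lform_lin lform_null // subr0.
(* Since [Q] is null, the form at [Q + s *: u] is [2 * s * lform Q r + s ^ 2 * lform u u];
   [s * D = lform Q r] makes the first term dominate. *)
pose D := lform Q r + `|lform u u|; have c0 := normr_ge0 (lform u u).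
pose s := lform Q r / D.
have D0 : 0 < D by rewrite /D; lra.
have s0 : 0 < s by rewrite divr_gt0.
have sD : s * D = lform Q r by rewrite /s divfK ?gt_eqF.
have s1 : s <= 1 by rewrite ler_pdivrMr // mul1r /D; lra.
have wC' : nbhs (Q + s *: u) C' by rewrite uE; apply: nbhs_convex => //; rewrite s0.
move: fC'; rewrite -subset0 => /(_ (Q + s *: u)); apply; split => //.
apply/QhE; rewrite !lform_lin lform_null // (lformC u Q) fu.
have := ler_norm (- lform u u); rewrite normrN /D in sD *; nra.
Qed.

End CsetMaximal.

(** * Redundancy of the constraints outside G *)

Section HyperplaneSection.
Variables (R : realType) (n m : nat).
Local Notation V := ('cV[R]_n * 'cV[R]_m)%type.
Variables (a : 'cV[R]_n) (d : 'cV[R]_m) (K : set V).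
Implicit Types (p q v w : V) (b c : 'cV[R]_m).
Hypotheses (m0 : (0 < m)%N) (a1 : enorm a <= 1).
Hypothesis Kmax : maximal_Qg_free a d K.

Let nm : (0 < n + m)%N. Proof. by rewrite addn_gt0 m0 orbT. Qed.
Let KH : K `<=` hyperplane a d. Proof. by case: Kmax => -[]. Qed.
Let Kdim : full_dimensional_in_hyperplane K. Proof. by case: Kmax => -[]. Qed.

(* Cauchy-Schwarz for [a] and [enorm p.2 *: g - p.1], then [4 t l <= (t l + 1)^2] with
   [t = enorm p.2] and [l = linform a d (g, b)]. *)
Lemma Qg_lform_ge g b p : usphere g -> usphere b -> Qg a d p ->
  p.2 = enorm p.2 *: b -> 2 * linform a d (g, b) <= lform (g, b) p.
Proof.
move=> /usphereE gg /usphereE bb [p12 /hyperplaneE Lp] p2.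
have := enorm_ge0 p.2; move: p12 Lp p2; rewrite /Qh /=; set t := enorm p.2.
move=> p12 Lp p2 t0.
have t_gt0 : 0 < t.
  rewrite lt_neqAle t0 andbT; apply/eqP => te; move: Lp.
  have p10 : p.1 = 0.
    by apply: enorm_eq0; apply/eqP; rewrite eq_le enorm_ge0 andbT te.
  by rewrite /linform p10 p2 -te scale0r !dot0r; lra.
have xx : dot p.1 p.1 <= t ^+ 2.
  by rewrite -sqr_enorm ler_pXn2r ?nnegrE ?enorm_ge0.
have aa : dot a a <= 1.
  by rewrite -sqr_enorm -(expr1n _ 2) ler_pXn2r ?nnegrE ?enorm_ge0.
have := cauchy_schwarz a (t *: g - p.1).
have := dot_ge0 (t *: g - p.1).
move: Lp; rewrite /linform /lform /= p2 !dot_lin gg bb (dotC p.1 g) => Lp w0 cs.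
rewrite -(ler_pM2l t_gt0).
set W := (X in _ <= _ * X) in cs w0.
have aaW : dot a a * W <= W by rewrite -[leRHS]mul1r ler_wpM2r.
have WE : W = t ^+ 2 - 2 * (t * dot g p.1) + dot p.1 p.1 by rewrite /W; ring.
have apE : dot a p.1 = - 1 - t * dot d b by lra.
have := sqr_ge0 (t * (dot a g + dot d b) - 1).
rewrite apE in cs; nra.
Qed.

Variable Gamma : 'cV[R]_m -> 'cV[R]_n.
Hypothesis Gamma1 : forall b, usphere b -> usphere (Gamma b).
Hypothesis KC : K `<=` Cset Gamma (@usphere R m).
Variable z : V.
Hypotheses (Kz : K z) (zC : nbhs z (Cset Gamma (@usphere R m))).

(** For [b] in [Gset] the maximum is 0 and the constraint is unchanged; other indices get the slack
    allowed by [Qg_lform_ge]. *)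
Definition relaxed : set V := hyperplane a d `&`
  [set p | forall b, usphere b ->
    lform (Gamma b, b) p <= 2 * Num.max 0 (linform a d (Gamma b, b))].

Lemma Cset_sub_relaxed : Cset Gamma (@usphere R m) `&` hyperplane a d `<=` relaxed.
Proof.
move=> p [/CsetE Cp Hp]; split => // b b1; apply: le_trans (Cp b b1) _.
by rewrite mulr_ge0 // le_max lexx.
Qed.

(** At a point [p] of [Qg], the relaxed constraint indexed by the direction [b] of [p.2] has no
    slack left. It is strict at [z], so prolonging the segment from [z] beyond [p] inside the
    hyperplane violates it, and [p] is not in the relative interior. *)
Lemma relaxed_Qg_free : Qg_free a d relaxed.
Proof.
have KK' : K `<=` relaxed.
  by move=> p Kp; apply: Cset_sub_relaxed; split; [exact: KC|exact: KH].
have K'H : relaxed `<=` hyperplane a d by move=> p [].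
have [K'dim K'E] := full_dim_in_hyperplaneS nm KH Kdim KK' K'H.
split => //.
- apply: closedI; first exact/closed_fun_eq/linform_continuous.
  rewrite (_ : [set p | _] = \bigcap_(b in @usphere R m)
      [set p | lform (Gamma b, b) p <= 2 * Num.max 0 (linform a d (Gamma b, b))]).
    by apply: closed_bigI => b _; apply: closed_fun_le; exact: lform_continuousr.
  by apply/seteqP; split.
- apply: comb_convex_set => p q t [/hyperplaneE Hp Cp] [/hyperplaneE Hq Cq] /andP[t0 t1].
  split; first by apply/hyperplaneE; rewrite !linform_lin Hp Hq; lra.
  move=> b b1; rewrite !lform_lin; have := Cp b b1; have := Cq b b1.
  by set M := 2 * _; nra.
- rewrite -subset0 => p [[K'p pK'] Qp].
  have [b b1 [p2 f0]] := Qh_direction Gamma1 m0 Qp.1.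
  have fl := Qg_lform_ge (Gamma1 b1) b1 Qp p2.
  have fz := Cset_interior_lt Gamma1 zC b1 b1.
  have [e e0 /(_ e)] := nbhs_line (p - z) pK'.
  rewrite lexx ltW // => /(_ isT); rewrite K'E => h.
  have /h[_ /(_ b b1)] : hyperplane a d (p + e *: (p - z)).
    apply/hyperplaneE; rewrite !linform_lin.
    by have /hyperplaneE -> := KH Kz; have /hyperplaneE -> := Qp.2; lra.
  have : 2 * Num.max 0 (linform a d (Gamma b, b)) <= lform (Gamma b, b) p.
    by case: (leP 0 (linform a d (Gamma b, b))) => _ //; lra.
  by rewrite !lform_lin; set M := 2 * _; nra.
Qed.

Lemma relaxed_sub : relaxed `<=` K.
Proof.
apply: contrapT => K'K; apply: Kmax.2; exists relaxed.
split; first exact: relaxed_Qg_free.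
split => // p Kp; apply: Cset_sub_relaxed; split; [exact: KC|exact: KH].
Qed.

Hypothesis Gamma_lip : forall b c, usphere b -> usphere c ->
  lform (Gamma b, b) (Gamma c, c) <= 0.

(* Near [p] the constraints of index outside [Gset] that may be violated have, by
   compactness, a slack bounded below in [relaxed]; hence one can walk from [z] to [p]
   with steps of constant length without leaving [relaxed = K]. *)
Lemma Cset_Gset_interior p : hyperplane a d p ->
  (forall b, Gset Gamma a d b -> lform (Gamma b, b) p < 0) -> K p.
Proof.
move=> /hyperplaneE Lp pG.
(* The pairs [(Gamma b, b)] whose constraint is tight or violated at [p], described by closed
   conditions: a point of [Cset] with two unit components lies on the graph of [Gamma], by the
   equality case of Cauchy-Schwarz. *)
pose A : set V := [set q | dot q.1 q.1 = 1] `&` [set q | dot q.2 q.2 = 1] `&`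
  Cset Gamma (@usphere R m) `&` [set q | 0 <= lform p q].
have AE q : A q -> usphere q.2 /\ q.1 = Gamma q.2.
  move=> [[[/= q1 q2] /CsetE Cq] _]; have b1 : usphere q.2 by apply/usphereE.
  split => //; apply/eqP; rewrite -subr_eq0; apply/eqP/dot_eq0/eqP.
  rewrite eq_le dot_ge0 andbT; have := Cq _ b1.
  have /usphereE gg := Gamma1 b1.
  by rewrite /lform /= q2 !dot_lin q1 gg (dotC q.1); lra.
have AG b : usphere b -> 0 <= lform (Gamma b, b) p -> A (Gamma b, b).
  move=> b1 fp; split; last by rewrite /= lformC.
  split; first by split; apply/usphereE => //; exact: Gamma1.
  by apply/CsetE => c c1; exact: Gamma_lip.
have [A0|A0] := pselect (A !=set0); last first.
  apply: relaxed_sub; apply: Cset_sub_relaxed; split => //; apply/CsetE => b b1.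
  rewrite leNgt; apply/negP => fp; apply: A0; exists (Gamma b, b).
  by apply: AG => //; exact: ltW.
have cA : closed A.
  apply: closedI; last exact/closed_fun_ge/lform_continuousr.
  apply: closedI; last exact: Cset_closed.
  apply: closedI.
  - apply: closed_fun_eq => q.
    apply: (@continuous_comp _ _ _ fst (fun u => dot u u)); first exact: cvg_fst.
    exact: dot_continuous_diag.
  - apply: closed_fun_eq => q.
    apply: (@continuous_comp _ _ _ snd (fun u => dot u u)); first exact: cvg_snd.
    exact: dot_continuous_diag.
have bA q : A q -> enorm q.1 <= 1 /\ enorm q.2 <= 1.
  by move=> /AE[b1 ->]; rewrite b1 (Gamma1 b1).
have [q Aq qmin] := bounded_closed_EVT A0 cA bA (@linform_continuous R n m a d).
set s := linform a d q in qmin.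
(* Otherwise the minimizer has its index in [Gset], where the constraint is strict at [p]. *)
have s0 : 0 < s.
  rewrite ltNge; apply/negP => s0; have [b1 q1] := AE _ Aq.
  have := pG q.2; rewrite -q1 -surjective_pairing.
  have Gq : Gset Gamma a d q.2 by split => //; rewrite -q1.
  by move=> /(_ Gq); case: Aq => _ /=; rewrite lformC; lra.
pose u := p - z; pose M := enorm u.1 + enorm u.2.
have fM b : usphere b -> lform (Gamma b, b) u <= M.
  move=> b1; have := dot_le_enorm b u.2; have := dot_le_enorm (Gamma b) (- u.1).
  rewrite enormN dotNr (Gamma1 b1) b1 /M /lform /=; lra.
have M0 : 0 <= M by rewrite addr_ge0 ?enorm_ge0.
(* A step of [N.+1%:R^-1 *: u] raises each constraint by at most [2 * s]. *)
have [N NM] : exists N : nat, M / (2 * s) < N.+1%:R.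
  exists (Num.truncn (M / (2 * s))); exact: truncnS_gt.
have N0 : 0 < N.+1%:R :> R by rewrite ltr0n.
have NMs : N.+1%:R^-1 * M <= 2 * s.
  by rewrite ler_pdivrMl //; move: NM; rewrite ltr_pdivrMr ?mulr_gt0 // => /ltW.
have step k : (k <= N.+1)%N -> K (z + (k%:R / N.+1%:R) *: u).
  elim: k => [_|k IH kN]; first by rewrite mul0r scale0r addr0.
  have {}IH := IH (ltnW kN).
  apply: relaxed_sub; split.
    apply/hyperplaneE; rewrite /u !linform_lin Lp.
    by have /hyperplaneE -> := KH Kz; ring.
  move=> b b1; have fz := Cset_interior_lt Gamma1 zC b1 b1.
  have k1 : k.+1%:R / N.+1%:R <= 1 :> R by rewrite ler_pdivrMr // mul1r ler_nat.
  have k0 : 0 <= k.+1%:R / N.+1%:R :> R by rewrite divr_ge0.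
  (* A constraint strict at both [z] and [p] holds between them. For the others, the previous point
     lies in [K], hence in [Cset], and one step uses at most the slack [2 * s]. *)
  have [fp|fp] := leP 0 (lform (Gamma b, b) p); last first.
    apply: (@le_trans _ _ 0); last by rewrite mulr_ge0 // le_max lexx.
    move: k0 k1; rewrite /u !lform_lin; set c := _ / _ => k0 k1.
    have : 0 <= (1 - c) * - lform (Gamma b, b) z by apply: mulr_ge0; lra.
    have : 0 <= c * - lform (Gamma b, b) p by apply: mulr_ge0; lra.
    lra.
  have := qmin _ (AG _ b1 fp) => sq.
  have /CsetE/(_ b b1) fw := KC IH.
  have -> : z + (k.+1%:R / N.+1%:R) *: u = z + (k%:R / N.+1%:R) *: u + N.+1%:R^-1 *: u.
    by rewrite -addrA -scalerDl; congr (_ + _ *: _); rewrite -natr1 mulrDl mul1r.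
  rewrite lformDr lformZr; apply: (@le_trans _ _ (0 + 2 * s)).
    by apply: lerD => //; apply: le_trans NMs; rewrite ler_pM2l ?invr_gt0 //; exact: fM.
  by rewrite add0r ler_pM2l // le_max sq orbT.
have := step N.+1 (leqnn _); rewrite divff ?gt_eqF // scale1r /u.
by rewrite addrC subrK.
Qed.

Lemma maximal_Qg_free_Cset_Gset : K = Cset Gamma (Gset Gamma a d) `&` hyperplane a d.
Proof.
apply/seteqP; split=> [p Kp|p [/CsetE pG Hp]].
  by split; [move=> b [b1 _]; exact: KC|exact: KH].
apply: relaxed_sub; apply: Cset_sub_relaxed; split => //; apply/CsetE => b b1.
rewrite leNgt; apply/negP => fp.
have fz c (c1 : usphere c) := Cset_interior_lt Gamma1 zC c1 c1.
have fzb := fz b b1.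
set F := lform (Gamma b, b) p in fp; set Z := lform (Gamma b, b) z in fzb.
(* Moving towards [z] makes the constraints of [Gset] strict; this [t] leaves the constraint of
   index [b] with the value [F / 2], still violated, although the new point is in [K]. *)
pose t := F / (F - Z) / 2.
have tE : t * (F - Z) = F / 2.
  by rewrite /t mulrAC divfK //; apply/eqP; lra.
have t01 : 0 < t < 1.
  rewrite /t; apply/andP; split; first by rewrite !divr_gt0 //; lra.
  rewrite ltr_pdivrMr // ltr_pdivrMr; lra.
have /KC/CsetE/(_ b b1) : K (p + t *: (z - p)).
  apply: Cset_Gset_interior.
    apply/hyperplaneE; rewrite !linform_lin.
    by have /hyperplaneE -> := KH Kz; move: Hp => /hyperplaneE ->; lra.
  move=> c Gc; have := fz c Gc.1; have := pG c Gc; rewrite !lform_lin; nra.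
by rewrite !lform_lin -/F -/Z; lra.
Qed.

End HyperplaneSection.

(** * Construction of [Gamma] and conclusion *)

Lemma maximal_Qg_free_Gamma (R : realType) (n m : nat) (a : 'cV[R]_n) (d : 'cV[R]_m)
    (K : set ('cV[R]_n * 'cV[R]_m)) : (0 < m)%N -> Qg_free a d K ->
  exists Gamma : 'cV[R]_m -> 'cV[R]_n, exists z,
    [/\ forall b, usphere b -> usphere (Gamma b),
        forall b c, usphere b -> usphere c -> lform (Gamma b, b) (Gamma c, c) <= 0,
        K `<=` Cset Gamma (@usphere R m), K z &
        nbhs z (Cset Gamma (@usphere R m))].
Proof.
move=> m0 Kfree; have nm : (0 < n + m)%N by rewrite addn_gt0 m0 orbT.
have [KH Kdim _ Kconv _] := Kfree.
have [z Kz zK] := cone_of_interior nm Kfree.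
have [C [KC cC nC maxC]] := maximal_lform_cone (cone_of_convex Kconv)
  (cone_of0 (free_nonempty nm Kfree)) (free_lform_le0 nm Kfree).
have C0 : C 0 by apply/KC/cone_of0; exists z.
have zC : nbhs z C by apply: filterS zK.
have /choice[Gamma G] : forall b : 'cV[R]_m, exists g : 'cV[R]_n, usphere b ->
    [/\ usphere g, C (g, b) & forall p, C p -> lform (g, b) p <= 0].
  (* Off the sphere the value 0 is an arbitrary default. *)
  move=> b; have [b1|nb] := pselect (usphere b); last by exists 0.
  by have [g ?] := separation cC C0 nC maxC zC b1; exists g.
have CC : C `<=` Cset Gamma (@usphere R m).
  by move=> p Cp; apply/CsetE => b /G[_ _]; exact.
exists Gamma, z; split => //.
- by move=> b /G[].
(* The contact point of index [c] lies in [C], on which the constraint of index [b] holds. *)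
- by move=> b c /G[_ _ h] /G[_ Cc _]; exact: h.
- by move=> p Kp; apply/CC/KC/cone_of_sub.
- by apply: filterS zC.
Qed.

Theorem theorem2 (R : realType) (n m : nat) (hn : (1 <= n)%N) (hm : (1 <= m)%N)
    (a : 'cV[R]_n) (d : 'cV[R]_m)
    (had : Num.max (enorm a) (enorm d) = 1)
    (K : set ('cV[R]_n * 'cV[R]_m))
    (hKdim : full_dimensional_in_hyperplane K)
    (hKmax : maximal_Qg_free a d K) :
  exists Gamma : 'cV[R]_m -> 'cV[R]_n,
    [/\ set_fun (@usphere R m) (@usphere R n) Gamma,
        full_dimensional (Cset Gamma (@usphere R m)),
        maximal_Qh_free (Cset Gamma (@usphere R m)) &
        K = Cset Gamma (Gset Gamma a d) `&` hyperplane a d].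
Proof.
have a1 : enorm a <= 1 by rewrite -had le_max lexx.
have [KH _ _ _ _] := hKmax.1.
have [Gamma [z [G1 Glip KC Kz zC]]] := maximal_Qg_free_Gamma hm hKmax.1.
have nm : (0 < n + m)%N by rewrite addn_gt0 hm orbT.
exists Gamma; split.
- exact: G1.
- exact: (full_dim_cone nm KH hKdim (Cset_cone Gamma _)
    (@Cset0 _ _ _ Gamma _) KC).
- exact: (Cset_maximal_Qh_free G1 hm Glip zC).
- exact: (maximal_Qg_free_Cset_Gset hm a1 hKmax G1 KC Kz zC Glip).
Qed.
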